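(* Let $L$ be a self-similar abelian group, let $L^{\omega}$ be a countably infinite direct sum of copies of $L$, and let $C_2$ be the cyclic group of order $2$. Then the wreath product $L^{\omega}\,\mathrm{wr}\,C_2$ is also self-similar.
   Context: $L^{\omega}\,\mathrm{wr}\,C_2 = (L^{\omega}\times L^{\omega})\rtimes C_2$, where the generator of $C_2$ interchanges the two factors. The direct sum $L^\omega$ consists of the sequences of elements of $L$ with only finitely many nontrivial entries. For a finite set $Y$ of size $m$, let $\mathcal{T}(Y)$ be the one-rooted regular $m$-ary tree whose vertices are the finite sequences over $Y$, and let $\mathcal{A}(Y)$ be its automorphism group. Each automorphism of the tree is identified with an automaton on the alphabet $Y$ whose states are again automorphisms of the tree (the state of $g$ at a vertex $u$ is the automorphism $g_u$ determined by $(uw)^g = u^g w^{g_u}$). A subgroup of $\mathcal{A}(Y)$ is state-closed if all states of its elements belong to the subgroup, and transitive if it acts transitively on the first level of the tree. A group $G$ is self-similar if for some finite positive integer $m$ it has a faithful representation as a state-closed and transitive subgroup of $\mathcal{A}(Y)$ with $|Y|=m$. Equivalently, $G$ is self-similar if and only if there exist a subgroup $H$ of finite index in $G$ and a homomorphism $f:H\to G$ such that the only subgroup $K\le H$ which is normal in $G$ and satisfies $K^f\le K$ is the trivial one (here $K^f$ denotes the image of $K$ under $f$). *)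

(* Defs.v *)
From HB Require Import structures.
From mathcomp Require Import all_boot all_order all_algebra all_fingroup.
From mathcomp Require Import finmap.
(* [boolp] supplies the choice structure on [seq Y -> seq Y]. *)
From mathcomp Require Import boolp classical_sets.

Set Implicit Arguments.
Unset Strict Implicit.
Unset Printing Implicit Defensive.

Local Open Scope group_scope.

Section Tree.
Variable Y : finType.
Implicit Types u v w : seq Y.

(* A vertex is a finite word over [Y], the root is [[::]], and the edges join a
   word [u] to the words [rcons u y]. *)
Definition child u v : bool := [exists y, v == rcons u y].

Definition is_tree_aut (g : seq Y -> seq Y) : Prop :=
  [/\ bijective g, g [::] = [::] & forall u v, child (g u) (g v) = child u v].

Record tree_aut := TreeAut {
  aut_fun :> seq Y -> seq Y;
  aut_funP : `[< is_tree_aut aut_fun >] }.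

HB.instance Definition _ := [isSub for aut_fun].
HB.instance Definition _ := [Choice of tree_aut by <:].

Lemma tree_autP (g : tree_aut) : is_tree_aut g.
Proof. exact/asboolP/aut_funP. Qed.

Lemma tree_aut_eq (g h : tree_aut) : g =1 h -> g = h.
Proof. by move=> gh; apply/val_inj/funext. Qed.

Lemma aut_one_subproof : is_tree_aut id.
Proof. by split=> //; exists id. Qed.

Definition aut_one := TreeAut (asboolT aut_one_subproof).

Lemma aut_mul_subproof (g h : tree_aut) : is_tree_aut (h \o g).
Proof.
have [gB g0 gC] := tree_autP g; have [hB h0 hC] := tree_autP h.
split; [exact: bij_comp | by rewrite /= g0 | by move=> u v; rewrite /= hC].
Qed.

(* Automorphisms act on the right, so that [g * h] applies [g] first. *)
Definition aut_mul (g h : tree_aut) := TreeAut (asboolT (aut_mul_subproof g h)).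

Lemma aut_inv_subproof (g : tree_aut) :
  exists h : tree_aut, cancel g h /\ cancel h g.
Proof.
have [[h gK hK] g0 gC] := tree_autP g.
suff hP : is_tree_aut h by exists (TreeAut (asboolT hP)).
split; first by exists g.
  by rewrite -[in LHS]g0 gK.
by move=> u v; rewrite -gC !hK.
Qed.

Definition aut_inv (g : tree_aut) : tree_aut := sval (cid (aut_inv_subproof g)).

Lemma aut_invK (g : tree_aut) : cancel g (aut_inv g).
Proof. by rewrite /aut_inv; case: cid => h []. Qed.

Lemma aut_invVK (g : tree_aut) : cancel (aut_inv g) g.
Proof. by rewrite /aut_inv; case: cid => h []. Qed.

Fact aut_mulA : associative aut_mul.
Proof. by move=> f g h; apply: tree_aut_eq. Qed.
Fact aut_mul1g : left_id aut_one aut_mul.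
Proof. by move=> g; apply: tree_aut_eq. Qed.
Fact aut_mulg1 : right_id aut_one aut_mul.
Proof. by move=> g; apply: tree_aut_eq. Qed.
Fact aut_mulVg : left_inverse aut_one aut_inv aut_mul.
Proof. by move=> g; apply: tree_aut_eq => u /=; rewrite aut_invVK. Qed.
Fact aut_mulgV : right_inverse aut_one aut_inv aut_mul.
Proof. by move=> g; apply: tree_aut_eq => u /=; rewrite aut_invK. Qed.

HB.instance Definition _ :=
  isGroup.Build tree_aut aut_mulA aut_mul1g aut_mulg1 aut_mulVg aut_mulgV.

Lemma aut_rcons (g : tree_aut) u y : exists z, g (rcons u y) = rcons (g u) z.
Proof.
have [_ _ gC] := tree_autP g.
have : child (g u) (g (rcons u y)) by rewrite gC; apply/existsP; exists y.
by case/existsP=> z /eqP; exists z.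
Qed.

Lemma size_aut (g : tree_aut) u : size (g u) = size u.
Proof.
elim/last_ind: u => [|u y IHu]; first by have [_ ->] := tree_autP g.
by have [z ->] := aut_rcons g u y; rewrite !size_rcons IHu.
Qed.

Definition state_fun (g : seq Y -> seq Y) u w := drop (size u) (g (u ++ w)).

Lemma state_funE (g : tree_aut) u w : g (u ++ w) = g u ++ state_fun g u w.
Proof.
rewrite -[LHS](cat_take_drop (size u)); congr (_ ++ _).
elim/last_ind: w => [|w y IHw].
  by rewrite cats0 -(size_aut g) take_size.
rewrite -rcons_cat; have [z ->] := aut_rcons g (u ++ w) y.
by rewrite -cats1 takel_cat // size_aut size_cat leq_addr.
Qed.

Lemma state_subproof (g : tree_aut) u : is_tree_aut (state_fun g u).
Proof.
have [_ _ gC] := tree_autP g.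
split.
- exists (state_fun (aut_inv g) (g u)) => w.
    by rewrite /state_fun -/(state_fun g u w) -state_funE aut_invK size_aut
       drop_size_cat.
  rewrite {1}/state_fun; have := state_funE (aut_inv g) (g u) w.
  by rewrite aut_invK => <-; rewrite aut_invVK -(size_aut g) drop_size_cat.
- by rewrite /state_fun cats0 -(size_aut g) drop_size.
have childE x v w : child (x ++ v) (x ++ w) = child v w.
  by apply: eq_existsb => y; rewrite rcons_cat eqseq_cat // eqxx.
by move=> v w; rewrite -(childE (g u)) -!state_funE gC childE.
Qed.

(* [state g u] is the automorphism [g_u] such that [(uw)^g = u^g w^(g_u)]. *)
Definition state (g : tree_aut) u : tree_aut :=
  TreeAut (asboolT (state_subproof g u)).

Lemma stateE (g : tree_aut) u w : g (u ++ w) = g u ++ state g u w.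
Proof. exact: state_funE. Qed.

Definition state_closed (S : set tree_aut) : Prop :=
  forall g u, S g -> S (state g u).

(* Words of length one are the vertices of the first level. *)
Definition level1_transitive (S : set tree_aut) : Prop :=
  forall x y : Y, exists2 g, S g & g [:: x] = [:: y].

End Tree.

(* The faithful representation is an injective morphism; its image is the
   state-closed transitive subgroup. *)
Definition self_similar (G : groupType) : Prop :=
  exists (Y : finType) (phi : {multiplicative G -> tree_aut Y}),
    [/\ 0 < #|Y|, injective phi, state_closed (range phi)
      & level1_transitive (range phi)].

Section DirectSum.
Variable L : groupType.

(* Direct sum: the default value [1] makes finite support part of the type. *)
Definition dsum : Type := {fsfun nat -> L with 1}.

HB.instance Definition _ := Choice.on dsum.
Implicit Types f g : dsum.

Definition dsum_one : dsum := [fsfun].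
Definition dsum_mul f g : dsum :=
  [fsfun i in (finsupp f `|` finsupp g)%fset => f i * g i].
Definition dsum_inv f : dsum := [fsfun i in finsupp f => (f i)^-1].

Lemma dsum_oneE i : dsum_one i = 1.
Proof. by rewrite fsfunE. Qed.

Lemma dsum_mulE f g i : dsum_mul f g i = f i * g i.
Proof.
rewrite fsfunE in_fsetU; case: (boolP (_ || _)) => // /norP[fi gi].
by rewrite !fsfun_dflt // mulg1.
Qed.

Lemma dsum_invE f i : dsum_inv f i = (f i)^-1.
Proof. by rewrite fsfunE; case: finsuppP => //= _; rewrite invg1. Qed.

Fact dsum_mulA : associative dsum_mul.
Proof. by move=> f g h; apply/fsfunP=> i; rewrite !dsum_mulE mulgA. Qed.
Fact dsum_mul1g : left_id dsum_one dsum_mul.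
Proof. by move=> f; apply/fsfunP=> i; rewrite dsum_mulE dsum_oneE mul1g. Qed.
Fact dsum_mulg1 : right_id dsum_one dsum_mul.
Proof. by move=> f; apply/fsfunP=> i; rewrite dsum_mulE dsum_oneE mulg1. Qed.
Fact dsum_mulVg : left_inverse dsum_one dsum_inv dsum_mul.
Proof.
by move=> f; apply/fsfunP=> i; rewrite dsum_mulE dsum_invE dsum_oneE mulVg.
Qed.
Fact dsum_mulgV : right_inverse dsum_one dsum_inv dsum_mul.
Proof.
by move=> f; apply/fsfunP=> i; rewrite dsum_mulE dsum_invE dsum_oneE mulgV.
Qed.

HB.instance Definition _ :=
  isGroup.Build dsum dsum_mulA dsum_mul1g dsum_mulg1 dsum_mulVg dsum_mulgV.

End DirectSum.

Section Wreath.
Variable B : groupType.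

(* [C_2] is the group ['Z_2], whose multiplicative law is addition modulo 2.  The
   pair [WrC2 b s] is the element [b s]; a record is used because the type
   [(B * B) * 'Z_2] already carries the direct product structure. *)
Record wrC2 := WrC2 { wr_base : B * B; wr_top : 'Z_2 }.

Definition wrC2_pair (x : wrC2) := (wr_base x, wr_top x).
Definition pair_wrC2 (p : (B * B) * 'Z_2) := WrC2 p.1 p.2.

Lemma wrC2_pairK : cancel wrC2_pair pair_wrC2.
Proof. by case. Qed.

HB.instance Definition _ := Choice.copy wrC2 (can_type wrC2_pairK).

Definition swap (s : 'Z_2) (b : B * B) : B * B :=
  if s == 1 then b else (b.2, b.1).

Lemma swap1 b : swap 1 b = b.
Proof. by rewrite /swap eqxx. Qed.

Lemma swapM s t b : swap (s * t) b = swap s (swap t b).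
Proof.
case: b => b1 b2; rewrite /swap.
by case: s t => [[|[|//]] ?] [[|[|//]] ?].
Qed.

Lemma swap_mul s b c : swap s (b * c) = swap s b * swap s c.
Proof. by rewrite /swap; case: ifP. Qed.

Lemma swap_one s : swap s 1 = 1.
Proof. by rewrite /swap; case: ifP. Qed.

(* [(b s) (c t) = (b (s c s^-1)) (s t)]. *)
Definition wr_mul (x y : wrC2) : wrC2 :=
  WrC2 (wr_base x * swap (wr_top x) (wr_base y)) (wr_top x * wr_top y).
Definition wr_one : wrC2 := WrC2 1 1.
Definition wr_inv (x : wrC2) : wrC2 :=
  WrC2 (swap (wr_top x)^-1 (wr_base x)^-1) (wr_top x)^-1.

Fact wr_mulA : associative wr_mul.
Proof.
by move=> x y z; rewrite /wr_mul /= swap_mul -swapM !mulgA.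
Qed.
Fact wr_mul1g : left_id wr_one wr_mul.
Proof. by case=> b s; rewrite /wr_mul /= swap1 !mul1g. Qed.
Fact wr_mulg1 : right_id wr_one wr_mul.
Proof. by case=> b s; rewrite /wr_mul /= swap_one !mulg1. Qed.
Fact wr_mulVg : left_inverse wr_one wr_inv wr_mul.
Proof. by case=> b s; rewrite /wr_mul /= -swap_mul !mulVg swap_one. Qed.
Fact wr_mulgV : right_inverse wr_one wr_inv wr_mul.
Proof. by case=> b s; rewrite /wr_mul /= -swapM !mulgV. Qed.

HB.instance Definition _ :=
  isGroup.Build wrC2 wr_mulA wr_mul1g wr_mulg1 wr_mulVg wr_mulgV.

End Wreath.

(* Main.v *)
Require Import Defs.
From mathcomp Require Import all_boot all_order all_algebra all_fingroup.
From HB Require Import structures.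
From mathcomp Require Import finmap boolp classical_sets.

(** A self-similar representation of [G] is the same thing as a faithful
    transitive wreath recursion: an action of [G] on a finite alphabet [Y] and,
    for each letter [y], a state map [g |-> g_y] into [G] with
    [(g h)_y = g_y h_(y^g)]; this is [self_similarP].  So let such a recursion be
    given for [L] over [Y]; one is needed for [L^omega wr C_2].

    The alphabet is ['Z_2 * Y].  The letter [(i, y)] looks at the factor [i] of
    the base group: [C_2] moves the label [i], and a pair of sequences moves [y]
    through the zeroth entry of the sequence with label [i].  If [a] is that
    sequence and [b] the other one, the state at [(i, y)] has trivial [C_2] part
    and the base part
<<
      ( (a_0)_y, 1, 1, ... )   and   ( b_1, b_2, b_3, ... ).
>>
    In terms of virtual endomorphisms: if [f : M -> L] is the one of [L], this is
    the map [(a, b) |-> ((f a_0, 1, 1, ...), shift b)], defined for [a_0] in [M].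

    Such a recursion is faithful because an element acting trivially has only
    states acting trivially.  Reading words whose labels stay at the first factor
    repeats the recursion of [L] on [a_0], so [a_0 = 1], and similarly [b_0 = 1].
    The shift brings every other entry of [b] to position zero after finitely many
    steps, and exchanging the roles of the factors does so for the entries of [a]
    ([wreath_kernel_entry]).  Placing [f a_0] and the shift on different factors
    keeps the two mechanisms apart, and the swap makes each of them available to
    both sequences. *)

Set Implicit Arguments.
Unset Strict Implicit.
Unset Printing Implicit Defensive.

Local Open Scope group_scope.

(** * Wreath recursions and self-similarity *)

(** These are the homomorphisms from [G] to the permutational wreath product of
    [G] with the symmetric group of [Y]. *)
Record recursion (G : groupType) (Y : Type) := Recursion {
  act : G -> Y -> Y;
  st : G -> Y -> G;
  act1 : forall y, act 1 y = y;
  actM : forall g h y, act (g * h) y = act h (act g y);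
  stM : forall g h y, st (g * h) y = st g y * st h (act g y) }.

Section Walk.
Variables (G : groupType) (Y : finType) (R : recursion G Y).
Implicit Types (g h : G) (u v w : seq Y).

Lemma st1 y : st R 1 y = 1.
Proof.
have := stM R 1 1 y; rewrite mul1g act1 => e.
by apply: (mulgI (st R 1 y)); rewrite mulg1 -e.
Qed.

Fixpoint walk g u : seq Y :=
  if u is y :: v then act R g y :: walk (st R g y) v else [::].

Fixpoint stw g u : G := if u is y :: v then stw (st R g y) v else g.

Lemma walk1 u : walk 1 u = u.
Proof. by elim: u => //= y u IHu; rewrite act1 st1 IHu. Qed.

Lemma walkM g h u : walk (g * h) u = walk h (walk g u).
Proof. by elim: u g h => //= y u IHu g h; rewrite actM stM IHu. Qed.

Lemma walk_cat g u w : walk g (u ++ w) = walk g u ++ walk (stw g u) w.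
Proof. by elim: u g => //= y u IHu g; rewrite IHu. Qed.

Lemma size_walk g u : size (walk g u) = size u.
Proof. by elim: u g => //= y u IHu g; rewrite IHu. Qed.

Lemma walk_child g u v : child u v -> child (walk g u) (walk g v).
Proof.
case/existsP=> y /eqP->; rewrite -cats1 walk_cat /= cats1.
by apply/existsP; exists (act R (stw g u) y).
Qed.

Lemma walk_tree_aut g : is_tree_aut (walk g).
Proof.
have gK: cancel (walk g) (walk g^-1) by move=> u; rewrite -walkM mulgV walk1.
have gVK: cancel (walk g^-1) (walk g) by move=> u; rewrite -walkM mulVg walk1.
split=> // [|u v]; first by exists (walk g^-1).
apply/idP/idP; last exact: walk_child.
by move/(walk_child g^-1); rewrite !gK.
Qed.

Definition walk_aut g : tree_aut Y := TreeAut (asboolT (walk_tree_aut g)).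

Fact walk_autM : {morph walk_aut : g h / g * h}.
Proof. by move=> g h; apply: tree_aut_eq => u; apply: walkM. Qed.

HB.instance Definition _ :=
  isMultiplicative.Build G (tree_aut Y) walk_aut walk_autM.

Lemma state_walk_aut g u : state (walk_aut g) u = walk_aut (stw g u).
Proof.
apply: tree_aut_eq => w.
change (drop (size u) (walk g (u ++ w)) = walk (stw g u) w).
by rewrite walk_cat -(size_walk g) drop_size_cat.
Qed.

Definition in_kernel g := forall u, walk g u = u.

Lemma in_kernel_act g y : in_kernel g -> act R g y = y.
Proof. by case/(_ [:: y]). Qed.

Lemma in_kernel_st g y : in_kernel g -> in_kernel (st R g y).
Proof. by move=> kg u; case: (kg (y :: u)). Qed.

End Walk.

Definition faithful_rec (G : groupType) (Y : finType) (R : recursion G Y) :=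
  forall g, in_kernel R g -> g = 1.

Definition transitive_rec (G : groupType) (Y : finType) (R : recursion G Y) :=
  forall x y, exists g, act R g x = y.

(** From right to left the recursion is run along words; from left to right the
    state of [phi g] at a letter is pulled back to [G] through [phi], which is
    possible and unambiguous since the range is state-closed and [phi] is
    injective. *)
Lemma self_similarP (G : groupType) :
  self_similar G <->
  exists (Y : finType) (R : recursion G Y),
    [/\ 0 < #|Y|, faithful_rec R & transitive_rec R].
Proof.
split=> [[Y [phi [Y0 phiI scl tr]]] | [Y [R [Y0 fR tR]]]]; last first.
  exists Y, (walk_aut R); split=> // [g h gh | g u [h _ <-] | x y].
  - apply: divg1_eq; apply: fR => u.
    have gh_walk v : walk R g v = walk R h v.
      exact: (congr1 (fun a : tree_aut Y => a v) gh).
    by rewrite walkM gh_walk -walkM mulgV walk1.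
  - by exists (stw R h u); rewrite // state_walk_aut.
  - have [g gxy] := tR x y; exists (walk_aut R g); first by exists g.
    by rewrite /= gxy.
have stP g y : exists h, phi h = state (phi g) [:: y].
  by have [|h _ e] := scl (phi g) [:: y]; [exists g | exists h].
pose a g y := head y (phi g [:: y]).
pose s g y := sval (cid (stP g y)).
have sE g y : phi (s g y) = state (phi g) [:: y] by rewrite /s; case: cid.
have phi_1 g y : phi g [:: y] = [:: a g y].
  by rewrite /a; have := size_aut (phi g) [:: y]; case: (phi g _) => [|z []].
have phi_cons g y w : phi g (y :: w) = a g y :: phi (s g y) w.
  by rewrite -cat1s stateE -sE phi_1.
have phi1 : phi 1 = 1.
  by apply: (mulgI (phi 1)); rewrite -gmulfM !mulg1.
have a1 y : a 1 y = y by rewrite /a phi1.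
have phiM g h w : phi (g * h) w = phi h (phi g w) by rewrite gmulfM.
have aM g h y : a (g * h) y = a h (a g y).
  by apply: (congr1 (head y) (_ : [:: _] = [:: _])); rewrite -!phi_1 phiM phi_1.
have sM g h y : s (g * h) y = s g y * s h (a g y).
  apply: phiI; apply: tree_aut_eq => w.
  have := phiM g h (y :: w).
  by rewrite !phi_cons phiM => -[_ ->].
pose R := Recursion a1 aM sM.
have walkE g u : walk R g u = phi g u.
  elim: u g => [|y u IHu] g; first by have [_ ->] := tree_autP (phi g).
  by rewrite phi_cons /= IHu.
exists Y, R; split=> // [g kg | x y].
  by apply: phiI; apply: tree_aut_eq => u; rewrite phi1 -walkE kg.
have [_ [g _ <-] gxy] := tr x y.
by exists g; rewrite /= /a gxy.
Qed.

(** * The zeroth summand and the shift of a direct sum *)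

Section DirectSumMaps.
Variable L : groupType.
Implicit Types (x y : L) (f g : dsum L).

Definition dhead x : dsum L := [fsfun i in [fset 0%N]%fset => x].

Lemma dheadE x i : dhead x i = if i == 0%N then x else 1.
Proof. by rewrite fsfunE inE. Qed.

Lemma dheadM x y : dhead (x * y) = dhead x * dhead y.
Proof.
by apply/fsfunP=> i; rewrite dsum_mulE !dheadE; case: ifP; rewrite ?mulg1.
Qed.

Definition dshift f : dsum L :=
  [fsfun i in [fset n.-1 | n in finsupp f]%fset => f i.+1].

Lemma dshiftE f i : dshift f i = f i.+1.
Proof.
rewrite fsfunE; case: ifPn => // /negP nfi; case: finsuppP => // fi.
by case: nfi; apply/imfsetP; exists i.+1.
Qed.

Lemma dshiftM f g : dshift (f * g) = dshift f * dshift g.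
Proof. by apply/fsfunP=> i; rewrite dsum_mulE !dshiftE dsum_mulE. Qed.

End DirectSumMaps.

(** * The recursion of the wreath product *)

Section WreathRecursion.
Variables (L : groupType) (Y : finType) (R : recursion L Y).
Let A := dsum L.
Implicit Types (x : wrC2 A) (i : 'Z_2) (y : Y).

(* The nontrivial element of [C_2], written additively. *)
Let t : 'Z_2 := 1%R.

Definition wr_act x (p : 'Z_2 * Y) : 'Z_2 * Y :=
  (p.1 * wr_top x, act R ((swap p.1 (wr_base x)).1 0%N) p.2).

Definition wr_st x (p : 'Z_2 * Y) : wrC2 A :=
  let b := swap p.1 (wr_base x) in
  WrC2 (dhead (st R (b.1 0%N) p.2), dshift b.2) 1.

Fact wr_act1 p : wr_act 1 p = p.
Proof.
by case: p => i y; rewrite /wr_act /= swap_one mulg1 dsum_oneE act1.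
Qed.

Fact wr_actM x z p : wr_act (x * z) p = wr_act z (wr_act x p).
Proof.
case: p => i y; rewrite /wr_act /= mulgA swap_mul -swapM.
by rewrite dsum_mulE actM.
Qed.

Fact wr_stM x z p : wr_st (x * z) p = wr_st x p * wr_st z (wr_act x p).
Proof.
case: p => i y; rewrite /wr_st /=.
rewrite [RHS]/(wr_mul _ _) /wr_mul /= swap1 mulg1 swap_mul -swapM.
by rewrite dsum_mulE stM dheadM dshiftM.
Qed.

Definition wr_rec := Recursion wr_act1 wr_actM wr_stM.

(** Along words with all labels at the first factor, the states keep the first
    factor first, so the recursion of [L] is recovered from its zeroth entry. *)
Lemma wr_walk_first (b : A * A) u :
  walk wr_rec (WrC2 b 1) [seq (1, y) | y <- u]
    = [seq (1, y) | y <- walk R (b.1 0%N) u].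
Proof.
elim: u b => //= y u IHu b; rewrite IHu /wr_act /= swap1 dheadE eqxx.
by rewrite mulg1.
Qed.

(** Only the first letter may need a label other than the first factor: the state
    there carries the entry followed from then on in the first factor. *)
Lemma wreath_kernel_head x i :
  faithful_rec R -> in_kernel wr_rec x -> (swap i (wr_base x)).1 0%N = 1.
Proof.
move=> fR kx; apply: fR => -[//|y u].
have /(congr1 (map snd)) := kx ((i, y) :: [seq (1, z) | z <- u]).
by rewrite /= wr_walk_first /= dheadE eqxx -!map_comp !map_id.
Qed.

(** The entry [n.+1] of one sequence is the entry [n] of the second component of
    the state at a letter labelled by the other sequence, and that state again
    acts trivially. *)
Lemma wreath_kernel_entry x n i :
  0 < #|Y| -> faithful_rec R -> in_kernel wr_rec x ->
  (swap i (wr_base x)).1 n = 1.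
Proof.
move=> /card_gt0P[y _] fR; elim: n x i => [|n IHn] x i kx.
  exact: wreath_kernel_head.
have := IHn _ t (in_kernel_st (t * i, y) kx).
by rewrite /= dshiftE swapM.
Qed.

Lemma wr_rec_faithful : 0 < #|Y| -> faithful_rec R -> faithful_rec wr_rec.
Proof.
move=> Y0 fR x kx; have [y _] := card_gt0P Y0.
have top1 := congr1 fst (in_kernel_act (1, y) kx).
have e1 n := wreath_kernel_entry n 1 Y0 fR kx.
have e2 n := wreath_kernel_entry n t Y0 fR kx.
case: x {kx} top1 e1 e2 => [[a b] s].
rewrite /act /= mul1g => -> /= e1 e2.
have -> : a = 1 by apply/fsfunP=> n; rewrite dsum_oneE; apply: e1.
have -> : b = 1 by apply/fsfunP=> n; rewrite dsum_oneE; apply: e2.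
by [].
Qed.

Lemma wr_rec_transitive : transitive_rec R -> transitive_rec wr_rec.
Proof.
move=> tR [i y] [j z]; have [l lyz] := tR y z.
exists (WrC2 (dhead l, dhead l) (i^-1 * j)).
by rewrite /= /wr_act /= mulKVg /swap; case: ifP => _ /=; rewrite dheadE lyz.
Qed.

End WreathRecursion.

Theorem theorem2 (L : groupType) (abL : forall x y : L, commute x y)
  (ssL : self_similar L) : self_similar (wrC2 (dsum L)).
Proof.
have [Y [R [Y0 fR tR]]] := (self_similarP L).1 ssL.
apply/self_similarP; exists ('Z_2 * Y)%type, (wr_rec R); split.
- by rewrite card_prod card_ord muln_gt0.
- exact: wr_rec_faithful.
- exact: wr_rec_transitive.
Qed.
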